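(* Let $\mathcal{V}$ be a Euclidean Jordan algebra. Suppose $E\subseteq\mathcal{V}$ is a weakly spectral set, $\Phi:\mathcal{V}\to\mathbb{R}$ is a weakly spectral function, and $F:\mathcal{V}\to\mathbb{R}$ is a function. If $a\in E$ is a local maximizer of the map $$x\in E\mapsto F(x)+\Phi(x)$$ and $F$ has an $E$-subgradient at $a$, then $a$ operator commutes with every element of $\partial_E F(a)$. If instead $a \in E$ is a local minimizer of this map and $-F$ has an $E$-subgradient at $a$, then $a$ operator commutes with every element of $\partial_E(-F)(a)$.
   Context: $\mathcal{V}$ is a Euclidean Jordan algebra with Jordan product $x\circ y$ and inner product $\langle x, y\rangle = \operatorname{tr}(x\circ y)$, where $\operatorname{tr}$ denotes the trace (the sum of the eigenvalues, counted with multiplicity, in the spectral decomposition with respect to a Jordan frame). An algebra automorphism is an invertible linear map $A:\mathcal{V}\to\mathcal{V}$ with $A(x\circ y)=A(x)\circ A(y)$ for all $x,y\in\mathcal{V}$; the set of these is $\operatorname{Aut}(\mathcal{V})$. A set $E\subseteq\mathcal{V}$ is weakly spectral if $A(E)\subseteq E$ for all $A\in\operatorname{Aut}(\mathcal{V})$. A function $\Phi:\mathcal{V}\to\mathbb{R}$ is weakly spectral if $\Phi(Ax)=\Phi(x)$ for all $x\in\mathcal{V}$ and $A\in\operatorname{Aut}(\mathcal{V})$. For $S\subseteq\mathcal{V}$, $a\in S$ and $F:\mathcal{V}\to\mathbb{R}$, the subdifferential of $F$ at $a$ relative to $S$ is $\partial_S F(a)=\{d\in\mathcal{V} : F(x)-F(a)\ge\langle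 d,x-a\rangle \text{ for all } x\in S\}$; its elements are called $S$-subgradients of $F$ at $a$. Elements $a,b\in\mathcal{V}$ operator commute if $L_aL_b=L_bL_a$, where $L_c(x)=c\circ x$; that is, $a\circ(b\circ x)=b\circ(a\circ x)$ for all $x\in\mathcal{V}$. *)

(* Defs.v *)
(** Euclidean Jordan algebras: the carrier is a finite-dimensional space
    [V : vectType R] over [R : realType]. *)
From HB Require Import structures.
From mathcomp Require Import all_boot all_order all_algebra.
From mathcomp Require Import boolp classical_sets reals.

Set Implicit Arguments.
Unset Strict Implicit.
Unset Printing Implicit Defensive.

Import Order.TTheory GRing.Theory Num.Theory.

Local Open Scope classical_set_scope.
Local Open Scope ring_scope.

Reserved Notation "x *j y" (at level 40, left associativity).

HB.mixin Record isEuclideanJordan (R : realType) V of Vector R V := {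
  jprod : V -> V -> V;
  junit : V;
  inner : V -> V -> R;
  jprod_is_linear : forall x, linear (jprod x);
  jprodC : forall x y, jprod x y = jprod y x;
  jordan_identity : forall x y,
    jprod x (jprod (jprod x x) y) = jprod (jprod x x) (jprod x y);
  junitP : forall x, jprod junit x = x;
  inner_is_linear : forall x, scalar (inner x);
  innerC : forall x y, inner x y = inner y x;
  inner_gt0 : forall x, x != 0 -> 0 < inner x x;
  innerA : forall x y z, inner (jprod x y) z = inner y (jprod x z)
}.

#[short(type="euclideanJordanType")]
HB.structure Definition EuclideanJordan (R : realType) :=
  { V of isEuclideanJordan R V & Vector R V }.

Notation "x *j y" := (jprod x y) : ring_scope.

Section EuclideanJordanAlgebra.
Context {R : realType} {V : euclideanJordanType R}.
Implicit Types (a b c d x y : V) (E S : set V) (F G Phi : V -> R).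

Definition idempotent c := c *j c = c.

Definition primitive_idempotent c :=
  [/\ idempotent c, c != 0 &
      ~ exists p q : V,
          [/\ idempotent p, idempotent q, p != 0, q != 0 & c = p + q]].

Definition jordan_frame (n : nat) (e : 'I_n -> V) :=
  [/\ forall i, primitive_idempotent (e i),
      forall i j, i != j -> e i *j e j = 0 &
      \sum_(i < n) e i = junit].

Definition spectral_decomposition x (n : nat) (e : 'I_n -> V) (l : 'I_n -> R) :=
  jordan_frame e /\ x = \sum_(i < n) l i *: e i.

(** By the spectral theorem a decomposition always exists, and the multiset of
    eigenvalues [l i] does not depend on it: the set below is a singleton, so
    the default value of [xget] is never used. *)
Definition jtrace x : R :=
  xget 0 [set t | exists (n : nat) (e : 'I_n -> V) (l : 'I_n -> R),
                    spectral_decomposition x e l /\ t = \sum_(i < n) l i].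

Definition algebra_automorphism (A : {linear V -> V}) :=
  bijective A /\ forall x y, A (x *j y) = A x *j A y.

Definition weakly_spectral_set E :=
  forall A : {linear V -> V}, algebra_automorphism A -> A @` E `<=` E.

Definition weakly_spectral_fun Phi :=
  forall (A : {linear V -> V}) x, algebra_automorphism A -> Phi (A x) = Phi x.

Definition inner_norm x : R := Num.sqrt (inner x x).

Definition local_maximizer E G a :=
  E a /\ exists2 eps : R, 0 < eps &
    forall x, E x -> inner_norm (x - a) < eps -> G x <= G a.

Definition local_minimizer E G a :=
  E a /\ exists2 eps : R, 0 < eps &
    forall x, E x -> inner_norm (x - a) < eps -> G a <= G x.

Definition subdifferential S F a : set V :=
  [set d | forall x, S x -> inner d (x - a) <= F x - F a].

Definition operator_commute a b := jprod a \o jprod b = jprod b \o jprod a.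

End EuclideanJordanAlgebra.

(* Main.v *)
(** Maximality of [a] along the automorphism orbits inside [E], together with
    the subgradient inequality, gives [inner d (A a - a) <= 0] for every
    automorphism [A] close to the identity. Taking [A = exp (t D)] for the
    derivation [D = L_u L_v - L_v L_u] and letting [t] tend to 0 from both sides
    yields [inner d (D a) = 0]; by associativity of the inner product this is
    [inner u ((L_a L_d - L_d L_a) v) = 0], for all [u] and [v]. *)
Require Import Defs.
From HB Require Import structures.
From mathcomp Require Import all_boot all_order all_algebra.
From mathcomp Require Import ring lra.
From mathcomp Require Import boolp classical_sets reals.
From mathcomp Require Import topology normedtype sequences exp.

Set Implicit Arguments.
Unset Strict Implicit.
Unset Printing Implicit Defensive.

Import Order.TTheory GRing.Theory Num.Theory.
Import numFieldNormedType.Exports.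

Local Open Scope classical_set_scope.
Local Open Scope ring_scope.

(** * A coordinate norm and boundedness of linear and bilinear maps *)

Section CoordinateNorm.
Context {R : realType} {V : vectType R}.
Implicit Types (x y z : V).

Local Notation b := (vbasis {:V}).

(** An l1 norm: bounds for maps are read off from their values on the basis, without compactness. *)
Definition cnorm x : R := \sum_(i < \dim {:V}) `|coord b i x|.

Definition seminorm (p : V -> R) :=
  (forall x y, p (x + y) <= p x + p y) /\ (forall c x, p (c *: x) = `|c| * p x).

Lemma cnorm_ge0 x : 0 <= cnorm x.
Proof. by apply: sumr_ge0. Qed.

Lemma cnormD x y : cnorm (x + y) <= cnorm x + cnorm y.
Proof.
rewrite -big_split /=; apply: ler_sum => i _.
by rewrite linearD; exact: ler_normD.
Qed.

Lemma cnormZ c x : cnorm (c *: x) = `|c| * cnorm x.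
Proof.
by rewrite mulr_sumr; apply: eq_bigr => i _; rewrite linearZ normrM.
Qed.

Lemma cnormN x : cnorm (- x) = cnorm x.
Proof. by rewrite -scaleN1r cnormZ normrN1 mul1r. Qed.

Lemma cnormC x y : cnorm (x - y) = cnorm (y - x).
Proof. by rewrite -cnormN opprB. Qed.

Lemma cnorm0 : cnorm 0 = 0.
Proof. by rewrite -(scale0r 0) cnormZ normr0 mul0r. Qed.

Lemma cnorm_sum (I : Type) (r : seq I) (P : pred I) (f : I -> V) :
  cnorm (\sum_(i <- r | P i) f i) <= \sum_(i <- r | P i) cnorm (f i).
Proof.
elim/big_ind2 : _ => [|x1 x2 y1 y2 h1 h2|//]; first by rewrite cnorm0.
exact: le_trans (cnormD _ _) (lerD h1 h2).
Qed.

Lemma coord_le_cnorm i x : `|coord b i x| <= cnorm x.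
Proof. by rewrite /cnorm (bigD1 i)//= lerDl sumr_ge0. Qed.

Lemma cnorm_le0 x : cnorm x <= 0 -> x = 0.
Proof.
move=> x0; rewrite (coord_vbasis (memvf x)) big1// => i _.
suff -> : coord b i x = 0 by rewrite scale0r.
by apply/eqP; rewrite -normr_le0 (le_trans (coord_le_cnorm i x)).
Qed.

(** Expand [x] in the basis, use subadditivity and homogeneity, and bound each coordinate by
    [cnorm x]. *)
Lemma seminorm_le_cnorm (p : V -> R) : seminorm p ->
  forall x, p x <= (\sum_(i < \dim {:V}) p b`_i) * cnorm x.
Proof.
move=> [pD pZ] x.
have p0 : p 0 = 0 by rewrite -(scale0r 0) pZ normr0 mul0r.
have p_ge0 y : 0 <= p y.
  have := pD y (- y); rewrite subrr p0 -scaleN1r pZ normrN1 mul1r.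
  by lra.
rewrite [in leLHS](coord_vbasis (memvf x)) mulr_suml.
apply: (@le_trans _ _ (\sum_(i < \dim {:V}) p (coord b i x *: b`_i))).
  elim/big_ind2 : _ => [|x1 x2 y1 y2 h1 h2|//]; first by rewrite p0.
  exact: le_trans (pD _ _) (lerD h1 h2).
apply: ler_sum => i _; rewrite pZ mulrC ler_wpM2l//.
exact: coord_le_cnorm.
Qed.

Lemma seminorm_bounded (p : V -> R) : seminorm p ->
  exists2 M, 0 <= M & forall x, p x <= M * cnorm x.
Proof.
move=> sp; exists `|\sum_(i < \dim {:V}) p b`_i| => // x.
apply: le_trans (seminorm_le_cnorm sp x) _.
by rewrite ler_wpM2r ?cnorm_ge0// ler_norm.
Qed.

(** Bounding in [x] for fixed [y] leaves the constant [M y], a finite sum of seminorms in [y], which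
    is bounded in turn. *)
Lemma biseminorm_bounded (q : V -> V -> R) :
  (forall x, seminorm (q x)) -> (forall y, seminorm (q^~ y)) ->
  exists2 M, 0 <= M & forall x y, q x y <= M * cnorm x * cnorm y.
Proof.
move=> qr ql.
pose M y := \sum_(i < \dim {:V}) q b`_i y.
have sM : seminorm M.
  split=> [x y|c x].
    by rewrite -big_split; apply: ler_sum => i _; have [+ _] := qr b`_i; exact.
  by rewrite mulr_sumr; apply: eq_bigr => i _; have [_] := qr b`_i; exact.
have [K K0 hK] := seminorm_bounded sM; exists K => // x y.
apply: le_trans (seminorm_le_cnorm (ql y) x) _.
by rewrite mulrAC ler_wpM2r ?cnorm_ge0// hK.
Qed.

Lemma linear_bounded (f : {linear V -> V}) :
  exists2 M, 0 <= M & forall x, cnorm (f x) <= M * cnorm x.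
Proof.
apply: seminorm_bounded; split=> [x y|c x]; first by rewrite linearD cnormD.
by rewrite linearZ cnormZ.
Qed.

End CoordinateNorm.

(** * Cauchy products of truncated series *)

Section TruncatedCauchyProduct.

(** The square is cut along the antidiagonal into the triangle [i + j < n], regrouped by
    [k = i + j], and the remaining corner. *)
Lemma sum_square_triangle (A : zmodType) (g : nat -> nat -> A) n :
  \sum_(0 <= j < n) \sum_(0 <= i < n) g i j =
  \sum_(0 <= k < n) \sum_(0 <= j < k.+1) g (k - j)%N j +
  \sum_(0 <= j < n) \sum_(n - j <= i < n) g i j.
Proof.
have -> : \sum_(0 <= k < n) \sum_(0 <= j < k.+1) g (k - j)%N j =
          \sum_(0 <= j < n) \sum_(0 <= i < n - j) g i j.
  elim: n => [|n IH]; first by rewrite !big_nil.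
  rewrite big_nat_recr//= IH.
  have -> : \sum_(0 <= j < n) \sum_(0 <= i < n - j) g i j =
            \sum_(0 <= j < n.+1) \sum_(0 <= i < n - j) g i j.
    by rewrite big_nat_recr//= subnn (big_geq (leqnn 0)) addr0.
  rewrite -big_split; apply: eq_big_nat => j /andP[_ jn].
  by rewrite subSn// big_nat_recr.
rewrite -big_split; apply: eq_big_nat => j _.
by rewrite -big_cat_nat ?leq_subr.
Qed.

Lemma exp_coeffDn (R : realType) (x y : R) n :
  exp_coeff (x + y) n = \sum_(0 <= i < n.+1) exp_coeff x (n - i)%N * exp_coeff y i.
Proof.
rewrite big_mkord /exp_coeff/= exprDn mulr_suml; apply: eq_bigr => i _.
have fact_neq0 k : k`!%:R != 0 :> R by rewrite pnatr_eq0 -lt0n fact_gt0.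
have ile : (i <= n)%N by rewrite -ltnS.
rewrite -(bin_fact ile) !natrM -mulr_natr.
have bin_neq0 : 'C(n, i)%:R != 0 :> R by rewrite pnatr_eq0 -lt0n bin_gt0.
by field; rewrite !fact_neq0 bin_neq0.
Qed.

(** By the binomial formula the triangle is the partial sum for [x + x]. This scalar corner will
    dominate the one that arises from [expmap]. *)
Lemma exp_coeff_tail (R : realType) (x : R) n :
  \sum_(0 <= j < n) \sum_(n - j <= i < n) exp_coeff x i * exp_coeff x j =
  series (exp_coeff x) n ^+ 2 - series (exp_coeff (x + x)) n.
Proof.
have := sum_square_triangle (fun i j => exp_coeff x i * exp_coeff x j) n.
under eq_bigr do rewrite -mulr_suml.
rewrite -mulr_sumr -expr2 => ->.
have -> : series (exp_coeff (x + x)) n = \sum_(0 <= k < n)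
    \sum_(0 <= j < k.+1) exp_coeff x (k - j)%N * exp_coeff x j.
  by apply: eq_bigr => k _; rewrite exp_coeffDn.
by rewrite addrAC subrr add0r.
Qed.

(** Both terms converge to [expR (x + x)]. *)
Lemma exp_coeff_tail_cvg0 (R : realType) (x : R) :
  (fun n => series (exp_coeff x) n ^+ 2 - series (exp_coeff (x + x)) n) @ \oo
  --> (0 : R).
Proof.
rewrite -(subrr (expR (x + x))) {1}expRD -expr2.
apply: cvgB; last exact: is_cvg_series_exp_coeff.
apply: cvgM; exact: is_cvg_series_exp_coeff.
Qed.

End TruncatedCauchyProduct.

(** * The polarized Jordan identity and inner derivations *)

Section JordanDerivations.
Context {R : realType} {V : euclideanJordanType R}.
Implicit Types (u v w x y z p : V).

HB.instance Definition _ x :=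
  GRing.isLinear.Build R V V *:%R (jprod x) (jprod_is_linear x).
HB.instance Definition _ x :=
  GRing.isLinear.Build R V R *%R (inner x) (inner_is_linear x).

Lemma jprodDr x y z : x *j (y + z) = x *j y + x *j z.
Proof. exact: linearD. Qed.

Lemma jprodDl x y z : (y + z) *j x = y *j x + z *j x.
Proof. by rewrite ![_ *j x]jprodC jprodDr. Qed.

Lemma jprodBr x y z : x *j (y - z) = x *j y - x *j z.
Proof. exact: linearB. Qed.

Lemma jprodBl x y z : (y - z) *j x = y *j x - z *j x.
Proof. by rewrite ![_ *j x]jprodC jprodBr. Qed.

Lemma jprodZr (c : R) x y : x *j (c *: y) = c *: (x *j y).
Proof. exact: linearZ. Qed.

Lemma jprodZl (c : R) x y : (c *: x) *j y = c *: (x *j y).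
Proof. by rewrite ![_ *j y]jprodC jprodZr. Qed.

(** Pairing with an arbitrary [p] turns vector identities into scalar ones, within reach of
    [lra]. *)
Lemma inner_inj x y : (forall p, inner p x = inner p y) -> x = y.
Proof.
move=> exy; apply/eqP; rewrite -subr_eq0; apply: contraT => /inner_gt0.
by rewrite linearB /= exy subrr ltxx.
Qed.

(** The Jordan identity is cubic in its first variable. The alternating sum of its instances at
    [x + y + z], at the pairwise sums and at the single variables leaves twice the claim. *)
Lemma jordan_identity_linearized x y z w :
  x *j ((y *j z) *j w) + y *j ((z *j x) *j w) + z *j ((x *j y) *j w) =
  (y *j z) *j (x *j w) + (z *j x) *j (y *j w) + (x *j y) *j (z *j w).
Proof.
apply: inner_inj => p.
have J a := congr1 (inner p) (jordan_identity a w).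
have := J (x + y + z); have := J (x + y); have := J (y + z); have := J (x + z).
have := J x; have := J y; have := J z.
rewrite !(jprodDl, jprodDr) !linearD /= (jprodC y x) (jprodC z x) (jprodC z y).
by lra.
Qed.

Definition derivation (D : V -> V) :=
  forall x y, D (x *j y) = D x *j y + x *j D y.

Definition jcomm u v x := u *j (v *j x) - v *j (u *j x).

Lemma jcomm_is_linear u v : linear (jcomm u v).
Proof.
by move=> c x y; rewrite /jcomm !(jprodDr, jprodZr) scalerBr opprD addrACA.
Qed.

HB.instance Definition _ u v :=
  GRing.isLinear.Build R V V *:%R (jcomm u v) (@jcomm_is_linear u v).

(* The instances [(u, x, y; v)] and [(v, x, y; u)] of the linearized identity
   have the same right-hand side. *)
Lemma jcomm_derivation u v : derivation (jcomm u v).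
Proof.
move=> x y; apply: inner_inj => p; rewrite /jcomm.
have := congr1 (inner p) (jordan_identity_linearized u x y v).
have := congr1 (inner p) (jordan_identity_linearized v x y u).
rewrite (jprodC (_ - _) y) !(linearD, linearB) /=.
rewrite !(jprodC _ v) !(jprodC _ u) !(jprodC _ x) !(jprodC _ y).
rewrite !linearN /= (jprodC (y *j u)) (jprodC (x *j u)).
by lra.
Qed.

End JordanDerivations.

(** * Passing to the limit in inequalities *)

Section CvgBounds.
Context {R : realType} {V : vectType R}.

Lemma ler_of_cvg0 (u : nat -> R) (a b : R) :
  u @ \oo --> 0 -> (forall n, a <= u n + b) -> a <= b.
Proof.
move=> u0 h; rewrite -subr_le0.
apply: (@ler_cvg_to _ _ _ _ (fun=> a - b) u) u0 _; first exact: cvg_cst.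
by apply: nearW => n; rewrite lerBlDr.
Qed.

Lemma cnorm_eq_of_cvg0 (u : nat -> R) (x y : V) :
  u @ \oo --> 0 -> (forall n, cnorm (x - y) <= u n) -> x = y.
Proof.
move=> u0 h; apply/eqP; rewrite -subr_eq0; apply/eqP/cnorm_le0.
by apply: (ler_of_cvg0 u0) => n; rewrite addr0.
Qed.

Lemma series_exp_coeff_le (x : R) n : 0 <= x -> series (exp_coeff x) n <= expR x.
Proof.
move=> x0; apply: nondecreasing_cvgn_le (is_cvg_series_exp_coeff x) n.
by apply: nondecreasing_series => k _ _; exact: exp_coeff_ge0.
Qed.

End CvgBounds.

(** * The exponential series of a linear map *)

Section ExponentialOfLinearMap.
Context {R : realType} {V : vectType R} (D : {linear V -> V}).
Implicit Types (x y z : V).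

Definition expmap_coeff n x : V := (n`!%:R)^-1 *: iter n D x.

Definition expmap_sum n x : V := \sum_(0 <= k < n) expmap_coeff k x.

(** Limits are taken coordinate by coordinate, so that only real sequences have to converge; they do
    by [expmap_sum_coord_cvg]. *)
Definition expmap x : V :=
  \sum_(i < \dim {:V})
    limn (fun n => coord (vbasis {:V}) i (expmap_sum n x)) *: (vbasis {:V})`_i.

Lemma expmap_coeffS n x :
  n.+1%:R *: expmap_coeff n.+1 x = D (expmap_coeff n x).
Proof.
rewrite /expmap_coeff iterS scalerA factS natrM invfM mulrA.
by rewrite divff ?pnatr_eq0// mul1r linearZ.
Qed.

Lemma expmap_coeff_linear n : linear (expmap_coeff n).
Proof.
move=> c x y; rewrite /expmap_coeff.
have -> : iter n D (c *: x + y) = c *: iter n D x + iter n D y.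
  by elim: n => //= n ->; rewrite linearP.
by rewrite scalerDr !scalerA mulrC.
Qed.

Lemma expmap_sum_linear n : linear (expmap_sum n).
Proof.
move=> c x y; rewrite /expmap_sum scaler_sumr -big_split.
by apply: eq_bigr => k _; rewrite expmap_coeff_linear.
Qed.

Variable M : R.
Hypotheses (M_ge0 : 0 <= M) (DM : forall x, cnorm (D x) <= M * cnorm x).

(** Each application of [D] costs a factor [M], so the series is dominated termwise by that of
    [expR M]. *)
Lemma cnorm_expmap_coeff n x :
  cnorm (expmap_coeff n x) <= exp_coeff M n * cnorm x.
Proof.
rewrite /expmap_coeff cnormZ ger0_norm ?invr_ge0// /exp_coeff/= mulrAC mulrC.
rewrite ler_wpM2r ?invr_ge0//.
elim: n => [|n IH]; first by rewrite expr0 mul1r.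
by rewrite iterS (le_trans (DM _))// exprS -mulrA ler_wpM2l.
Qed.

Lemma cnorm_expmap_sum n x : cnorm (expmap_sum n x) <= expR M * cnorm x.
Proof.
apply: le_trans (cnorm_sum _ _ _) _.
apply: le_trans (ler_sum _ (fun k _ => cnorm_expmap_coeff k x)) _.
rewrite -mulr_suml ler_wpM2r ?cnorm_ge0//.
exact: series_exp_coeff_le.
Qed.

Lemma expmap_sum_coord_cvg i x :
  cvgn (fun n => coord (vbasis {:V}) i (expmap_sum n x)).
Proof.
rewrite (_ : (fun n => _) =
  series (fun k => coord (vbasis {:V}) i (expmap_coeff k x))); last first.
  by apply/funext => n; rewrite linear_sum.
apply: (@normed_cvg _ R^o).
apply: (@series_le_cvg _ _ (fun k => cnorm x * exp_coeff M k)) => [|k|k|].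
- by move=> n /=.
- by rewrite mulr_ge0 ?cnorm_ge0 ?exp_coeff_ge0.
- by rewrite mulrC (le_trans (coord_le_cnorm _ _))// cnorm_expmap_coeff.
- exact: (is_cvg_seriesZ (k := cnorm x) (is_cvg_series_exp_coeff M)).
Qed.

Lemma expmap_sum_cvg x :
  (fun n => cnorm (expmap_sum n x - expmap x)) @ \oo --> (0 : R).
Proof.
(* The limit 0 is written as a sum of zeros, one per coordinate. *)
rewrite -(@big1 R 0 +%R _ (index_enum 'I_(\dim {:V})) xpredT (fun=> 0))//.
apply: cvg_big => [|i _]; first exact: add_continuous.
under eq_fun do rewrite linearB /= coord_sum_free ?(basis_free (vbasisP _))//.
rewrite -(normr0 R); apply: cvg_norm; apply/subr_cvg0.
exact: expmap_sum_coord_cvg.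
Qed.

Lemma cnorm_expmap x : cnorm (expmap x) <= expR M * cnorm x.
Proof.
apply: (ler_of_cvg0 (expmap_sum_cvg x)) => n.
apply: le_trans (lerD (lexx _) (cnorm_expmap_sum n x)).
rewrite cnormC -{1}(subrK (expmap_sum n x) (expmap x)).
exact: cnormD.
Qed.

(** Partial sums are linear, so the defect is at most a combination of the truncation errors at
    [c *: x + y], [x] and [y]. *)
Lemma expmap_linear : linear expmap.
Proof.
move=> c x y.
have : (fun n => cnorm (expmap_sum n (c *: x + y) - expmap (c *: x + y)) +
    (`|c| * cnorm (expmap_sum n x - expmap x) +
     cnorm (expmap_sum n y - expmap y))) @ \oo --> (0 + (`|c| * 0 + 0) : R).
  apply: cvgD; first exact: expmap_sum_cvg.
  by apply: cvgD; [apply: cvgMl_tmp|]; exact: expmap_sum_cvg.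
rewrite mulr0 !addr0 => /cnorm_eq_of_cvg0; apply.
move=> n; rewrite -cnormZ.
rewrite -(subrKA (expmap_sum n (c *: x + y))) (le_trans (cnormD _ _))//.
rewrite cnormC lerD2l expmap_sum_linear opprD addrACA -scalerBr.
exact: cnormD.
Qed.

(** The remainder is the series from degree 2 on; since [k.+2]! >= k[!], a factor [M ^+ 2] comes out
    and the series of [expR M] is left. *)
Lemma cnorm_expmap_sub x :
  cnorm (expmap x - x - D x) <= M ^+ 2 * expR M * cnorm x.
Proof.
(* The shift by two puts the terms of degree 0 and 1 in every partial sum. *)
apply: (ler_of_cvg0 (_ : (fun n => cnorm (expmap_sum n.+2 x - expmap x)) @ \oo --> 0)).
  by have := expmap_sum_cvg x; rewrite -(cvg_shiftn 2); under eq_fun do rewrite addn2.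
move=> n; rewrite (cnormC (expmap_sum _ _)).
have -> : expmap x - x - D x = (expmap x - expmap_sum n.+2 x) +
    \sum_(0 <= k < n) expmap_coeff k.+2 x.
  rewrite /expmap_sum big_nat_recl// big_nat_recl//= /expmap_coeff/=.
  by rewrite fact0 (_ : 1`! = 1%N)// invr1 !scale1r !opprD !addrA subrK.
apply: le_trans (cnormD _ _) _; rewrite lerD2l.
apply: le_trans (cnorm_sum _ _ _) _.
apply: (@le_trans _ _ (\sum_(0 <= k < n) M ^+ 2 * (exp_coeff M k * cnorm x))).
  apply: ler_sum => k _; apply: le_trans (cnorm_expmap_coeff _ _) _.
  rewrite mulrA ler_wpM2r ?cnorm_ge0// /exp_coeff/=.
  rewrite -[k.+2]/(2 + k)%N exprD -mulrA.
  rewrite ler_wpM2l ?exprn_ge0// ler_wpM2l ?exprn_ge0// lef_pV2 ?posrE ?ltr0n ?fact_gt0//.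
  by rewrite ler_nat (leq_trans (_ : k`! <= k.+1`!)%N)// factS leq_pmull.
rewrite -mulr_sumr -mulrA ler_wpM2l ?exprn_ge0// -mulr_suml ler_wpM2r ?cnorm_ge0//.
exact: series_exp_coeff_le.
Qed.

End ExponentialOfLinearMap.

(** * Exponentials of small derivations are automorphisms *)

Section ExponentialOfDerivation.
Context {R : realType} {V : euclideanJordanType R} (D : {linear V -> V}).
Hypothesis D_der : derivation D.
Implicit Types (x y : V).

(** The Leibniz rule for [iter n D], divided by [n!]. *)
Lemma expmap_coeff_jprod n x y :
  expmap_coeff D n (x *j y) =
  \sum_(0 <= i < n.+1) expmap_coeff D (n - i)%N x *j expmap_coeff D i y.
Proof.
elim: n => [|n IH].
  by rewrite big_nat1 /expmap_coeff/= fact0 invr1 !scale1r.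
have n1_neq0 : n.+1%:R != 0 :> R by rewrite pnatr_eq0.
apply: (scalerI n1_neq0); rewrite expmap_coeffS IH linear_sum scaler_sumr.
(* The weight [n.+1] splits as [(n.+1 - i) + i]. The first part vanishes at [i = n.+1], the second
   at [i = 0]; what remains is [D] acting on the left and on the right factor. *)
transitivity (\sum_(0 <= i < n.+2)
    ((n.+1 - i)%:R *: (expmap_coeff D (n.+1 - i)%N x *j expmap_coeff D i y) +
     i%:R *: (expmap_coeff D (n.+1 - i)%N x *j expmap_coeff D i y))); last first.
  apply: eq_big_nat => i /andP[_ ile].
  by rewrite -scalerDl -natrD subnK.
rewrite big_split/= [X in _ = X + _]big_nat_recr//= subnn mulr0n scale0r addr0.
rewrite [X in _ = _ + X]big_nat_recl//= mulr0n scale0r add0r -big_split/=.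
apply: eq_big_nat => i /andP[_ ile].
rewrite D_der subSS -!expmap_coeffS subSn//.
by congr (_ + _); [exact: jprodZl|exact: jprodZr].
Qed.

(** By the Leibniz rule the triangle is the partial sum at [x *j y], so only the corner survives. *)
Lemma expmap_sum_jprod n x y :
  expmap_sum D n x *j expmap_sum D n y - expmap_sum D n (x *j y) =
  \sum_(0 <= j < n) \sum_(n - j <= i < n) expmap_coeff D i x *j expmap_coeff D j y.
Proof.
have := sum_square_triangle (fun i j => expmap_coeff D i x *j expmap_coeff D j y) n.
have -> : \sum_(0 <= j < n) \sum_(0 <= i < n) expmap_coeff D i x *j expmap_coeff D j y =
    expmap_sum D n x *j expmap_sum D n y.
  rewrite /expmap_sum linear_sum; apply: eq_bigr => j _ /=.
  by rewrite jprodC linear_sum; apply: eq_bigr => i _; rewrite jprodC.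
move=> ->; have -> : expmap_sum D n (x *j y) = \sum_(0 <= k < n)
    \sum_(0 <= j < k.+1) expmap_coeff D (k - j)%N x *j expmap_coeff D j y.
  by apply: eq_bigr => k _; rewrite expmap_coeff_jprod.
by rewrite addrAC subrr add0r.
Qed.

Variable M : R.
Hypotheses (M_ge0 : 0 <= M) (DM : forall x, cnorm (D x) <= M * cnorm x).

Lemma jprod_bounded :
  exists2 K : R, 0 <= K & forall x y, cnorm (x *j y) <= K * cnorm x * cnorm y.
Proof.
apply: (@biseminorm_bounded _ _ (fun x y => cnorm (x *j y))) => [x|y]; split.
- by move=> y z; rewrite jprodDr cnormD.
- by move=> c y; rewrite jprodZr cnormZ.
- by move=> x z; rewrite jprodDl cnormD.
- by move=> c x; rewrite jprodZl cnormZ.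
Qed.

(* The truncation error of the product is bounded by the truncation error of
   [expR M * expR M = expR (M + M)]. *)
Lemma cnorm_expmap_sum_jprod K n x y :
  (forall x y, cnorm (x *j y) <= K * cnorm x * cnorm y) -> 0 <= K ->
  cnorm (expmap_sum D n x *j expmap_sum D n y - expmap_sum D n (x *j y)) <=
  (K * cnorm x * cnorm y) *
    (series (exp_coeff M) n ^+ 2 - series (exp_coeff (M + M)) n).
Proof.
move=> hK K0; rewrite expmap_sum_jprod -exp_coeff_tail mulr_sumr.
apply: le_trans (cnorm_sum _ _ _) _; apply: ler_sum => j _; rewrite mulr_sumr.
apply: le_trans (cnorm_sum _ _ _) _; apply: ler_sum => i _.
apply: le_trans (hK _ _) _.
rewrite -mulrA [leRHS](_ : _ =
  K * ((exp_coeff M i * cnorm x) * (exp_coeff M j * cnorm y))); last by ring.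
by rewrite ler_wpM2l// ler_pM ?cnorm_ge0 ?cnorm_expmap_coeff.
Qed.

Lemma expmap_jprod x y : expmap D (x *j y) = expmap D x *j expmap D y.
Proof.
have [K K0 hK] := jprod_bounded.
pose err z n := cnorm (expmap_sum D n z - expmap D z).
have err_cvg z : err z @ \oo --> (0 : R) by exact: expmap_sum_cvg M_ge0 DM z.
have : (fun n => err (x *j y) n +
    ((K * cnorm x * cnorm y) *
        (series (exp_coeff M) n ^+ 2 - series (exp_coeff (M + M)) n) +
     (K * (expR M * cnorm y) * err x n + K * (expR M * cnorm x) * err y n))) @ \oo
  --> (0 + (K * cnorm x * cnorm y * 0 +
        (K * (expR M * cnorm y) * 0 + K * (expR M * cnorm x) * 0)) : R).
  apply: cvgD; first exact: err_cvg.
  apply: cvgD; first by apply: cvgMl_tmp; exact: exp_coeff_tail_cvg0.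
  by apply: cvgD; apply: cvgMl_tmp; exact: err_cvg.
rewrite !mulr0 !addr0 => /cnorm_eq_of_cvg0; apply => n.
set X := expmap_sum D n x; set Y := expmap_sum D n y.
(* The error splits into the truncation at [x *j y], the corner of the Cauchy product, and the
   replacement of [X] and [Y] by their limits, one factor at a time. *)
have -> : expmap D (x *j y) - expmap D x *j expmap D y =
    - (expmap_sum D n (x *j y) - expmap D (x *j y)) +
    (- (X *j Y - expmap_sum D n (x *j y)) +
    ((X - expmap D x) *j Y + expmap D x *j (Y - expmap D y))).
  by rewrite jprodBl jprodBr !opprB !addrA !subrK.
apply: le_trans (cnormD _ _) _; apply: lerD; first by rewrite cnormN.
apply: le_trans (cnormD _ _) _; apply: lerD.
  by rewrite cnormN cnorm_expmap_sum_jprod.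
apply: le_trans (cnormD _ _) _; apply: lerD; apply: le_trans (hK _ _) _.
  rewrite mulrAC ler_wpM2r ?cnorm_ge0// ler_wpM2l//.
  exact: cnorm_expmap_sum M_ge0 DM n y.
rewrite ler_wpM2r ?cnorm_ge0// ler_wpM2l//.
exact: cnorm_expmap M_ge0 DM x.
Qed.

(** Smallness gives bijectivity: if [expmap D x = 0], the second-order estimate bounds [cnorm x] by
    itself times a constant below 1, so the kernel is trivial, and an injective endomorphism in
    finite dimension is invertible. *)
Lemma expmap_automorphism : M + M ^+ 2 * expR M < 1 ->
  exists2 A : {linear V -> V}, algebra_automorphism A & A =1 expmap D.
Proof.
move=> M1; pose L := GRing.isLinear.Build R V V *:%R (expmap D)
  (expmap_linear M_ge0 DM).
pose A : {linear V -> V} := HB.pack (expmap D) L.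
exists A => //; split; last exact: expmap_jprod.
have Aker : lker (linfun A) == 0%VS.
  rewrite -subv0; apply/subvP => x; rewrite memv_ker memv0 lfunE/= => /eqP Ax0.
  apply/eqP/cnorm_le0.
  have h : cnorm x <= (M + M ^+ 2 * expR M) * cnorm x.
    rewrite mulrDl [leLHS](_ : _ = cnorm (D x + (expmap D x - x - D x))).
      apply: le_trans (cnormD _ _) (lerD (DM x) _).
      exact: cnorm_expmap_sub M_ge0 DM x.
    by rewrite Ax0 addrCA subrr addr0 sub0r cnormN.
  by have := cnorm_ge0 x; nra.
exists (linfun A)^-1%VF => x.
  by rewrite -{1}(lfunE A) lker0_lfunK.
by rewrite -(lfunE A) lker0_lfunVK.
Qed.

End ExponentialOfDerivation.

(** * The first-order condition along automorphism orbits *)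

Section FirstOrderCondition.
Context {R : realType} {V : euclideanJordanType R}.
Implicit Types (a d u v x y : V) (E : set V).

Lemma inner_bounded :
  exists2 K : R, 0 <= K & forall x y, `|inner x y| <= K * cnorm x * cnorm y.
Proof.
apply: (@biseminorm_bounded _ _ (fun x y => `|inner x y|)) => [x|y]; split.
- by move=> y z; rewrite linearD; exact: ler_normD.
- by move=> c y; rewrite linearZ normrM.
- by move=> x z; rewrite !(innerC _ y) linearD; exact: ler_normD.
- by move=> c x; rewrite !(innerC _ y) linearZ normrM.
Qed.

(** Local extrema are measured by [inner_norm], the exponential by [cnorm]; this bound passes from
    one to the other. *)
Lemma inner_norm_bounded :
  exists2 K : R, 0 <= K & forall x, inner_norm x <= K * cnorm x.
Proof.
have [K K0 hK] := inner_bounded; exists (Num.sqrt K); first exact: sqrtr_ge0.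
move=> x; rewrite -[cnorm x]ger0_norm ?cnorm_ge0// -sqrtr_sqr -sqrtrM//.
rewrite ler_wsqrtr// expr2 mulrA.
exact: le_trans (ler_norm _) (hK x x).
Qed.

(** The exponential of [t \*: D], whose bound is [s = |t| * M], serves as [A]; its second-order
    remainder is quadratic in [t]. *)
Lemma derivation_orbit (D : {linear V -> V}) a : derivation D ->
  exists2 C : R, 0 <= C & exists2 r : R, 0 < r &
  forall t : R, `|t| < r -> exists2 A : {linear V -> V},
    algebra_automorphism A & cnorm (A a - a - t *: D a) <= C * t ^+ 2.
Proof.
move=> D_der; have [M M0 hM] := linear_bounded D.
have e1 : 0 < expR (1 : R) := expR_gt0 1.
exists (M ^+ 2 * expR 1 * cnorm a).
  by rewrite !mulr_ge0 ?cnorm_ge0 ?exprn_ge0// ltW.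
have r0 : 0 < (M + 1) * (1 + expR 1) by nra.
(* This radius forces [s * (1 + expR 1) < 1], hence [s <= 1] and [s + s ^+ 2 * expR s < 1]. Using
   [M + 1] keeps it meaningful when [M = 0]. *)
exists ((M + 1) * (1 + expR 1))^-1; first by rewrite invr_gt0.
move=> t; rewrite -[_^-1]mul1r ltr_pdivlMr// => ht.
have t0 : 0 <= `|t| by [].
pose s := `|t| * M; have s0 : 0 <= s by rewrite mulr_ge0.
have se : s * (1 + expR 1) < 1 by rewrite /s; nra.
have s1 : s <= 1 by nra.
have es : expR s <= expR 1 by rewrite ler_expR.
have tD_der : derivation (t \*: D).
  by move=> x y /=; rewrite D_der scalerDr jprodZl jprodZr.
have tDM x : cnorm ((t \*: D) x) <= s * cnorm x.
  by rewrite /= cnormZ -mulrA ler_wpM2l.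
have [A autA AE] : exists2 A : {linear V -> V},
    algebra_automorphism A & A =1 expmap (t \*: D).
  apply: (expmap_automorphism tD_der s0 tDM).
  have se2 : s * (s * expR s) <= s * (1 * expR 1).
    by rewrite ler_wpM2l// ler_pM ?expR_ge0.
  by rewrite expr2; lra.
exists A => //; rewrite AE.
apply: le_trans (cnorm_expmap_sub s0 tDM a) _.
rewrite [leRHS](_ : _ = s ^+ 2 * expR 1 * cnorm a).
  by rewrite ler_wpM2r ?cnorm_ge0// ler_wpM2l ?exprn_ge0.
by rewrite /s exprMn real_normK ?num_real//; ring.
Qed.

(** Testing at [t = s * g] with [s > 0] small covers both signs of [g]: if [g] were nonzero,
    [s * |K| >= 1] would follow. *)
Lemma linear_le_quadratic (g K r : R) : 0 < r ->
  (forall t, `|t| < r -> t * g <= K * t ^+ 2) -> g = 0.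
Proof.
move=> r0 h; apply/eqP; apply: contraT => g0.
(* One factor of the denominator gives [s * |g| < r], the other [s * |K| < 1]. *)
pose s := r / ((1 + `|g|) * (1 + r * `|K|)).
have g_ge0 : 0 <= `|g| by [].
have rK0 : 0 <= r * `|K| by rewrite mulr_ge0// ltW.
have den0 : 0 < (1 + `|g|) * (1 + r * `|K|) by nra.
have s0 : 0 < s by rewrite divr_gt0.
have sden : s * ((1 + `|g|) * (1 + r * `|K|)) = r by rewrite divfK ?gt_eqF.
have sg : s * `|g| < r by nra.
have sK : s * `|K| < 1.
  have : r * (s * `|K|) < r * 1 by nra.
  by rewrite ltr_pM2l.
have := h (s * g); rewrite normrM gtr0_norm// => /(_ sg).
have g2 : 0 < g ^+ 2 by rewrite exprn_even_gt0.
have sg2 : 0 < s * g ^+ 2 by rewrite mulr_gt0.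
move=> hs.
have : s * g ^+ 2 * 1 <= s * g ^+ 2 * (s * `|K|).
  rewrite [leLHS](_ : _ = s * g * g); last by ring.
  apply: le_trans hs _; rewrite [leRHS](_ : _ = `|K| * (s * g) ^+ 2).
    by rewrite ler_wpM2r ?sqr_ge0// ler_norm.
  by ring.
by rewrite ler_pM2l// leNgt sK.
Qed.

Lemma local_maximizer_derivation E (Phi F : V -> R) a d (D : {linear V -> V}) :
  weakly_spectral_set E -> weakly_spectral_fun Phi -> derivation D ->
  local_maximizer E (fun x => F x + Phi x) a -> subdifferential E F a d ->
  inner d (D a) = 0.
Proof.
move=> hE hPhi D_der [Ea [eps eps0 amax]] hd.
have [C C0 [r r0 orbit]] := derivation_orbit a D_der.
have [K K0 hK] := inner_norm_bounded; have [K' K'0 hK'] := inner_bounded.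
have c0 := cnorm_ge0 (D a); set c := cnorm (D a) in c0.
pose B := K * (c + C); have B0 : 0 <= B by rewrite mulr_ge0 ?addr_ge0.
(* The three bounds on [t] serve in turn to obtain [A], to have [t ^+ 2 <= |t|], and to keep [A a]
   within [eps] of [a], as [inner_norm (A a - a) <= |t| * B]. *)
apply: (@linear_le_quadratic _ (K' * cnorm d * C)
  (Num.min r (Num.min 1 (eps / (B + 1))))).
  by rewrite !lt_min r0 ltr01 divr_gt0// ltr_wpDl.
move=> t; rewrite !lt_min => /and3P[tr t1]; rewrite ltr_pdivlMr ?ltr_wpDl// => teps.
have [A autA hA] := orbit t tr.
have EAa : E (A a) by apply: (hE A autA); exists a.
have t0 : 0 <= `|t| by [].
have t2 : t ^+ 2 <= `|t| by rewrite -[t ^+ 2]real_normK ?num_real//; nra.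
have Aa : A a - a = t *: D a + (A a - a - t *: D a) by rewrite [RHS]addrC subrK.
have near : inner_norm (A a - a) < eps.
  apply: le_lt_trans (hK _) (le_lt_trans _ teps).
  have : cnorm (A a - a) <= `|t| * (c + C).
    rewrite Aa; apply: le_trans (cnormD _ _) _.
    rewrite cnormZ mulrDr lerD2l; apply: le_trans hA _.
    by rewrite mulrC ler_wpM2r.
  by move=> /(ler_wpM2l K0) /le_trans; apply; rewrite /B; nra.
(* [Phi] takes equal values at [A a] and [a] and cancels; the subgradient inequality then bounds
   [t * inner d (D a)] by minus the pairing of [d] with the remainder. *)
have := amax _ EAa near; rewrite hPhi// lerD2r => FA.
have := hd _ EAa; rewrite Aa linearD linearZ /= => hdA.
have := hK' d (A a - a - t *: D a); rewrite ler_norml => /andP[+ _].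
have : K' * cnorm d * cnorm (A a - a - t *: D a) <= K' * cnorm d * (C * t ^+ 2).
  by rewrite ler_wpM2l// mulr_ge0 ?cnorm_ge0.
lra.
Qed.

Lemma local_maximizer_operator_commute E (Phi F : V -> R) a d :
  weakly_spectral_set E -> weakly_spectral_fun Phi ->
  local_maximizer E (fun x => F x + Phi x) a -> subdifferential E F a d ->
  operator_commute a d.
Proof.
move=> hE hPhi amax hd; apply/funext => v /=; apply: inner_inj => u.
have := local_maximizer_derivation hE hPhi (jcomm_derivation u v) amax hd.
rewrite /jcomm linearB /= => /eqP; rewrite subr_eq0 => /eqP.
(* Self-adjointness of multiplication isolates [u]: one side becomes [inner u (d *j (a *j v))], the
   other [inner u (a *j (d *j v))]. *)
rewrite -innerA (jprodC u d) innerA (jprodC v a) => ->.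
by rewrite -innerA innerC (jprodC d v) innerA (jprodC a u).
Qed.

End FirstOrderCondition.

Theorem theorem1p2 (R : realType) (V : euclideanJordanType R)
    (inner_trace : forall x y : V, inner x y = jtrace (x *j y))
    (E : set V) (Phi F : V -> R) (a : V)
    (hE : weakly_spectral_set E) (hPhi : weakly_spectral_fun Phi)
    (ha : E a) :
  (local_maximizer E (fun x => F x + Phi x) a ->
   subdifferential E F a !=set0 ->
   forall d, subdifferential E F a d -> operator_commute a d) /\
  (local_minimizer E (fun x => F x + Phi x) a ->
   subdifferential E (fun x => - F x) a !=set0 ->
   forall d, subdifferential E (fun x => - F x) a d -> operator_commute a d).
Proof.
split=> [amax _ d|amin _ d].
  exact: (@local_maximizer_operator_commute _ _ E Phi F).
(* A minimizer of [F + Phi] is a maximizer of [- F - Phi], and [- Phi] is again weakly spectral. *)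
apply: (@local_maximizer_operator_commute _ _ E (fun x => - Phi x) (fun x => - F x)).
- by [].
- by move=> A x autA; rewrite hPhi.
have [Ea [eps eps0 h]] := amin; split=> //; exists eps => // x Ex xa.
by have := h x Ex xa; lra.
Qed.
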